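(* Let $X_1,\dots,X_n$ be an independent sample from a density $f\in\mathcal{F}_0$ on the one-dimensional tree space $\mathcal{T}_3$, with $n\ge 2$. Then, with probability one, a maximum likelihood estimator $\hat f_n$ of $f$ in $\mathcal{F}_0$ exists and is unique, i.e. there is a unique maximizer $\hat f_n\in\mathcal{F}_0$ of the log-likelihood $l(g)=\sum_{i=1}^n\log g(X_i)$ over $g\in\mathcal{F}_0$.
   Context: $\mathcal{T}_3$ (the BHV tree space of metric 3-trees) is the metric space obtained by gluing three closed half-lines $O_1,O_2,O_3\cong\mathbb{R}_{\ge 0}$ at their common endpoint $0$ (the origin); the distance between points in the same half-line is the absolute difference of coordinates, and between $x\in O_i$, $y\in O_j$ with $i\ne j$ it is $d(x,0)+d(0,y)$. It is a Hadamard (CAT(0)) space. The base measure $\nu$ on $\mathcal{T}_3$ is the sum of the Lebesgue measures on the three open half-lines (the origin has measure zero), completed. Geodesics, convex sets and concave functions are as in a Hadamard space: $(1-\lambda)x+\lambda y$ is the point on the unique geodesic from $x$ to $y$ at distance $\lambda d(x,y)$ from $x$; a function $\phi:\mathcal{T}_3\to[-\infty,\infty]$ is concave if its hypograph $\{(x,\mu):\mu\le\phi(x)\}$ is a convex subset of $\mathcal{T}_3\times\mathbb{R}$ (i.e. contains the geodesic between any two of its points). A density $g\ge 0$ with $\int g\,d\nu=1$ is log-concave if $\log g$ (with $\log 0=-\infty$) is concave. $\mathcal{F}_0$ denotes the set of log-concave probability densities with respect to $\nu$ on $\mathcal{T}_3$. *)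

(* Defs.v *)
From HB Require Import structures.
From mathcomp Require Import all_boot all_order all_algebra.
From mathcomp Require Import all_classical all_reals all_analysis.
Set Implicit Arguments. Unset Strict Implicit. Unset Printing Implicit Defensive.
Import Order.TTheory GRing.Theory Num.Theory.
Local Open Scope classical_set_scope.
Local Open Scope ring_scope.

Section Tree3.
Variable R : realType.

(* A point of T_3 is a pair (branch k, coordinate r >= 0); the origin is
   represented canonically as (ord0, 0), so that representations are unique. *)
Definition validp (p : 'I_3 * R) : bool :=
  (0 <= p.2) && ((p.2 == 0) ==> (p.1 == ord0)).

Definition T3 := {p : 'I_3 * R | validp p}.

Lemma orig_valid : validp (ord0, 0).
Proof. by rewrite /validp /= lexx eqxx. Qed.

Definition orig : T3 := exist _ (ord0, 0) orig_valid.

Definition br (x : T3) : 'I_3 := (sval x).1.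
Definition rad (x : T3) : R := (sval x).2.

(* the point at distance r from the origin on branch k (origin if r <= 0) *)
Definition mkT (k : 'I_3) (r : R) : T3 :=
  if insub (k, r) is Some x then (if 0 < r then x else orig) else orig.

Definition tdist (x y : T3) : R :=
  if br x == br y then `|rad x - rad y| else rad x + rad y.

(* (1 - lam) x + lam y : the point on the geodesic from x to y at distance
   lam * d(x, y) from x *)
Definition geo (x y : T3) (lam : R) : T3 :=
  if br x == br y then mkT (br x) ((1 - lam) * rad x + lam * rad y)
  else let t := lam * (rad x + rad y) in
       if t <= rad x then mkT (br x) (rad x - t) else mkT (br y) (t - rad x).

Definition elog (t : R) : \bar R := if t <= 0 then -oo%E else (ln t)%:E.

(* concavity: the hypograph {(x, mu) : mu <= phi x} in T_3 x R is convex *)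
Definition tconcave (phi : T3 -> \bar R) : Prop :=
  forall (x y : T3) (mu mu' lam : R), 0 <= lam <= 1 ->
    (mu%:E <= phi x)%E -> (mu'%:E <= phi y)%E ->
    (((1 - lam) * mu + lam * mu')%:E <= phi (geo x y lam))%E.

Definition trace (A : set T3) (k : 'I_3) : set R :=
  [set r : R | 0 < r /\ A (mkT k r)].

Definition tint (A : set T3) (g : T3 -> R) : \bar R :=
  (\sum_(k < 3)
     \int[@lebesgue_measure R]_(r in trace A k) (g (mkT k r))%:E)%E.

Definition tmeasurable (A : set T3) : Prop :=
  forall k : 'I_3, measurable (trace A k).

Definition tdensity (g : T3 -> R) : Prop :=
  (forall x, 0 <= g x) /\
  (forall k : 'I_3, measurable_fun [set r : R | 0 < r] (fun r => g (mkT k r))) /\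
  tint setT g = 1%E.

Definition F0 (g : T3 -> R) : Prop := tdensity g /\ tconcave (fun x => elog (g x)).

Definition loglik (n : nat) (xs : 'I_n -> T3) (g : T3 -> R) : \bar R :=
  (\sum_(i < n) elog (g (xs i)))%E.

Definition is_mle (n : nat) (xs : 'I_n -> T3) (g : T3 -> R) : Prop :=
  F0 g /\ forall h, F0 h -> (loglik xs h <= loglik xs g)%E.

Definition mle_exists_unique (n : nat) (xs : 'I_n -> T3) : Prop :=
  exists g, is_mle xs g /\ forall g', is_mle xs g' -> g' = g.

End Tree3.

(* Main.v *)
Require Import Defs.
From HB Require Import structures.
From mathcomp Require Import all_boot all_order all_algebra.
From mathcomp Require Import all_classical all_reals all_analysis.
From mathcomp Require Import measurable_realfun.
From mathcomp Require Import ring lra.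
Import Order.TTheory GRing.Theory Num.Theory.
Import numFieldNormedType.Exports.
(* [rad] is also a MathComp name. *)
Import Defs.
Local Open Scope classical_set_scope.
Local Open Scope ring_scope.

(** Almost surely two observations differ, and then the statement holds for every
    fixed sample.

    Existence: for heights [y : 'I_n -> R] let [tent y] be the least log-concave
    function with values at least [expR (y i)] at the observations. A density
    in [F0] dominates the tent through its own log-values, so it suffices to maximise
    [score y = \sum_i y i - n * ln (mass of tent y)]. Shifting [y] by a constant
    multiplies the tent, hence [score] is shift invariant and Lipschitz; it is
    coercive modulo shifts because the tent stays above [expR (-1)] on a segment of
    length proportional to [1 / (max y - min y)]. Hence the maximum is attained on a
    compact box.

    Uniqueness: normalising any log-concave function cannot beat a maximiser. Applied
    to the restriction to the convex hull of the sample, this shows that a maximiser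
    is supported by the hull; applied to the geometric mean of two maximisers, that
    these agree almost everywhere, hence at every point strictly between two
    observations; applied to their maximum, which is again log-concave, that they agree
    at the observations. *)

Set Implicit Arguments. Unset Strict Implicit. Unset Printing Implicit Defensive.

(** * Geometry of the tripod *)

Section Geometry.
Context {R : realType}.
Implicit Types (x y z : T3 R) (j k l : 'I_3) (r s t c lam : R).

Lemma rad_ge0 x : 0 <= rad x.
Proof. by case: x => -[k r] v; case/andP: (v). Qed.

Lemma sval_mkT k r : 0 < r -> sval (mkT k r) = (k, r).
Proof.
move=> r0; rewrite /mkT; case: insubP => [u _ uE|]; first by rewrite r0 -uE.
by rewrite /validp /= ltW //= gt_eqF.
Qed.

Lemma br_mkT k r : 0 < r -> br (mkT k r) = k.
Proof. by move=> r0; rewrite /br sval_mkT. Qed.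

Lemma rad_mkT k r : 0 < r -> rad (mkT k r) = r.
Proof. by move=> r0; rewrite /rad sval_mkT. Qed.

Lemma mkT_le0 k r : r <= 0 -> mkT k r = orig R.
Proof.
by move=> r0; rewrite /mkT; case: insubP => // u _ _; rewrite ltNge r0.
Qed.

Lemma rad_eq0 x : rad x = 0 -> x = orig R.
Proof.
case: x => -[k r] v r0; apply: val_inj; move: (v) r0.
by rewrite /validp /rad /= => /andP[_ /implyP +] /eqP r0 => /(_ r0) /eqP ->; rewrite (eqP r0).
Qed.

Lemma mkT_br_rad x : mkT (br x) (rad x) = x.
Proof.
have [/eqP r0|r0] := boolP (rad x == 0).
  by rewrite mkT_le0 ?r0// (rad_eq0 r0).
apply: val_inj => /=; rewrite sval_mkT; last by rewrite lt_neqAle eq_sym r0 rad_ge0.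
by rewrite /br /rad; case: (sval x).
Qed.

Lemma geo_origl y lam : 0 <= lam -> geo (orig R) y lam = mkT (br y) (lam * rad y).
Proof.
move=> l0; rewrite /geo; have rad0 : rad (orig R) = 0 by [].
case: ifPn => [/eqP e|_]; first by rewrite rad0 mulr0 add0r e.
rewrite rad0 add0r subr0; case: ifPn => // lr.
by rewrite !mkT_le0//; have := mulr_ge0 l0 (rad_ge0 y); lra.
Qed.

Lemma geo_origr x lam : lam <= 1 -> geo x (orig R) lam = mkT (br x) ((1 - lam) * rad x).
Proof.
move=> l1; rewrite /geo; have rad0 : rad (orig R) = 0 by [].
case: ifPn => [/eqP e|_]; first by rewrite rad0 mulr0 addr0.
have h : lam * rad x <= rad x by rewrite ler_piMl// rad_ge0.
by rewrite rad0 addr0 h mulrBl mul1r.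
Qed.

Lemma geo_same_branch k r r' lam : 0 <= r -> 0 <= r' -> 0 <= lam <= 1 ->
  geo (mkT k r) (mkT k r') lam = mkT k ((1 - lam) * r + lam * r').
Proof.
move=> r0 r'0 /andP[l0 l1].
have [rp|rn] := ltP 0 r; have [r'p|r'n] := ltP 0 r'.
- by rewrite /geo !br_mkT// eqxx !rad_mkT.
- have -> : r' = 0 by lra.
  by rewrite (@mkT_le0 k 0)// geo_origr// br_mkT// rad_mkT// mulr0 addr0.
- have -> : r = 0 by lra.
  by rewrite (@mkT_le0 k 0)// geo_origl// br_mkT// rad_mkT// mulr0 add0r.
- have -> : r = 0 by lra. have -> : r' = 0 by lra.
  by rewrite !mulr0 addr0 !(@mkT_le0 k 0)// geo_origl// mkT_le0//= mulr0.
Qed.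

Lemma geo_diff_branch j k r r' lam : j != k -> 0 <= r -> 0 <= r' -> 0 <= lam <= 1 ->
  geo (mkT j r) (mkT k r') lam =
  if lam * (r + r') <= r then mkT j (r - lam * (r + r')) else mkT k (lam * (r + r') - r).
Proof.
move=> jk r0 r'0 /andP[l0 l1].
have [rp|rn] := ltP 0 r; have [r'p|r'n] := ltP 0 r'.
- by rewrite /geo !br_mkT// (negbTE jk) !rad_mkT.
- have -> : r' = 0 by lra.
  have h : lam * r <= r by rewrite ler_piMl.
  by rewrite (@mkT_le0 k 0)// geo_origr// br_mkT// rad_mkT// addr0 h mulrBl mul1r.
- have -> : r = 0 by lra.
  rewrite (@mkT_le0 j 0)// geo_origl// br_mkT// rad_mkT// add0r subr0.
  by case: ifPn => // h; rewrite !mkT_le0//; have := mulr_ge0 l0 r'0; lra.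
- have -> : r = 0 by lra. have -> : r' = 0 by lra.
  by rewrite addr0 !mulr0 !subr0 lexx !(@mkT_le0 _ 0)// geo_origl// mkT_le0//= mulr0.
Qed.

Definition line j l t : T3 R := if t <= 0 then mkT j (- t) else mkT l t.

Lemma line_ge0 j l t : 0 <= t -> line j l t = mkT l t.
Proof.
by move=> t0; rewrite /line; case: ifPn => // tn; rewrite !mkT_le0//; lra.
Qed.

Lemma line_le0 j l t : t <= 0 -> line j l t = mkT j (- t).
Proof. by move=> t0; rewrite /line t0. Qed.

Lemma line_opp j l t : line j l (- t) = line l j t.
Proof.
have [t0|/ltW t0] := leP 0 t.
  by rewrite line_le0 ?line_ge0 ?opprK//; lra.
by rewrite line_ge0 ?line_le0//; lra.
Qed.

Lemma geo_line_mixed j l s t lam : j != l -> s <= 0 -> 0 <= t -> 0 <= lam <= 1 ->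
  geo (line j l s) (line j l t) lam = line j l ((1 - lam) * s + lam * t).
Proof.
move=> jl s0 t0 l01; rewrite line_le0// line_ge0// geo_diff_branch//; last by lra.
case: ifPn => h.
  by rewrite line_le0; [congr (mkT _ _); ring|lra].
by rewrite line_ge0; [congr (mkT _ _); ring|lra].
Qed.

Lemma geo_line_ge0 j l s t lam : 0 <= s -> 0 <= t -> 0 <= lam <= 1 ->
  geo (line j l s) (line j l t) lam = line j l ((1 - lam) * s + lam * t).
Proof.
move=> s0 t0 /andP[l0 l1]; rewrite !line_ge0 ?geo_same_branch ?l0//.
by apply: addr_ge0; apply: mulr_ge0 => //; lra.
Qed.

Lemma geo_line j l s t lam : j != l -> 0 <= lam <= 1 ->
  geo (line j l s) (line j l t) lam = line j l ((1 - lam) * s + lam * t).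
Proof.
move=> jl l01.
have lj : l != j by rewrite eq_sym.
have e : (1 - lam) * s + lam * t = - ((1 - lam) * - s + lam * - t) by ring.
have [s0|/ltW s0] := leP 0 s; have [t0|/ltW t0] := leP 0 t.
- exact: geo_line_ge0.
- have := @geo_line_mixed l j (- s) (- t) lam lj; rewrite !line_opp => ->; rewrite ?oppr_le0 ?oppr_ge0//.
  by rewrite e line_opp.
- exact: geo_line_mixed.
- have := @geo_line_ge0 l j (- s) (- t) lam; rewrite !line_opp => ->; rewrite ?oppr_le0 ?oppr_ge0//.
  by rewrite e line_opp.
Qed.

Lemma other_branch k : exists j, j != k.
Proof.
by have [->|h] := eqVneq k ord0; [exists (Ordinal (isT : 1 < 3)%N)|exists ord0; rewrite eq_sym].
Qed.

Lemma common_line x y : exists j l s t, [/\ j != l, x = line j l s & y = line j l t].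
Proof.
have [xy|xy] := eqVneq (br x) (br y).
  have [j jl] := other_branch (br x).
  exists j, (br x), (rad x), (rad y); split => //.
    by rewrite line_ge0 ?rad_ge0// mkT_br_rad.
  by rewrite line_ge0 ?rad_ge0// xy mkT_br_rad.
exists (br x), (br y), (- rad x), (rad y); split => //.
  by rewrite line_le0 ?opprK ?mkT_br_rad// oppr_le0 rad_ge0.
by rewrite line_ge0 ?rad_ge0// mkT_br_rad.
Qed.

Lemma geo0 x y : geo x y 0 = x.
Proof.
have [j [l [s [t [jl -> ->]]]]] := common_line x y.
by rewrite geo_line ?lexx ?ler01// subr0 mul1r mul0r addr0.
Qed.

Lemma geo1 x y : geo x y 1 = y.
Proof.
have [j [l [s [t [jl -> ->]]]]] := common_line x y.
by rewrite geo_line ?lexx ?ler01// subrr mul1r mul0r add0r.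
Qed.

Lemma geoxx x lam : 0 <= lam <= 1 -> geo x x lam = x.
Proof.
move=> l01; have [j [l [s [t [jl -> _]]]]] := common_line x x.
by rewrite geo_line//; congr (line _ _ _); ring.
Qed.

Lemma geo_geo x y a b lam : 0 <= a <= 1 -> 0 <= b <= 1 -> 0 <= lam <= 1 ->
  geo (geo x y a) (geo x y b) lam = geo x y ((1 - lam) * a + lam * b).
Proof.
move=> a01 b01 l01; have [j [l [s [t [jl -> ->]]]]] := common_line x y.
rewrite !geo_line//; last first.
  move: a01 b01 l01 => /andP[a0 a1] /andP[b0 b1] /andP[l0 l1].
  by apply/andP; split; nra.
by congr (line _ _ _); ring.
Qed.

Lemma geo_initial_branch x y : x != y -> exists k a b lam,
  [/\ 0 <= a, 0 <= b, a != b, 0 < lam <= 1 &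
   forall t, 0 <= t <= 1 -> geo x y (lam * t) = mkT k ((1 - t) * a + t * b)].
Proof.
move=> xy; have [e|e] := eqVneq (br x) (br y).
  exists (br x), (rad x), (rad y), 1; split; rewrite ?rad_ge0 ?ltr01 ?lexx//.
    apply: contra xy => /eqP r; apply/eqP.
    by rewrite -(mkT_br_rad x) -(mkT_br_rad y) e r.
  move=> t t01; rewrite mul1r -{1}(mkT_br_rad x) -{1}(mkT_br_rad y) -e.
  by rewrite geo_same_branch ?rad_ge0.
have [r0|r0] := eqVneq (rad x) 0.
  exists (br y), 0, (rad y), 1; rewrite rad_ge0 lexx ltr01 lexx; split => //.
    apply: contra xy => /eqP r; apply/eqP.
    by rewrite (rad_eq0 r0) (rad_eq0 (esym r)).
  move=> t /andP[t0 t1]; rewrite mul1r mulr0 add0r.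
  by rewrite (rad_eq0 r0) geo_origl.
have xp : 0 < rad x by rewrite lt_neqAle eq_sym r0 rad_ge0.
have yp := rad_ge0 y; have sp : 0 < rad x + rad y by lra.
exists (br x), (rad x), 0, (rad x / (rad x + rad y)); split => //; first exact: ltW.
  by rewrite divr_gt0//= ler_pdivrMr//; lra.
move=> t /andP[t0 t1]; rewrite -{1}(mkT_br_rad x) -{1}(mkT_br_rad y).
have h : rad x / (rad x + rad y) * t * (rad x + rad y) = t * rad x by field; lra.
rewrite geo_diff_branch ?rad_ge0 ?h//; last first.
  apply/andP; split; first by rewrite mulr_ge0// divr_ge0// ltW.
  by rewrite -(ler_pM2r sp) h mul1r; nra.
rewrite ifT; last by nra.
by congr (mkT _ _); ring.
Qed.

Definition signed_rad k x : R := if br x == k then rad x else - rad x.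

Lemma signed_rad_mkT j k r : 0 <= r ->
  signed_rad k (mkT j r) = if j == k then r else - r.
Proof.
move=> r0; rewrite /signed_rad; have [rp|rn] := ltP 0 r.
  by rewrite br_mkT// rad_mkT.
have -> : r = 0 by lra.
by rewrite mkT_le0// /rad/= oppr0 !if_same.
Qed.

Lemma signed_rad_line j k l t : j != l -> signed_rad k (line j l t) =
  if k == l then t else if k == j then - t else - `|t|.
Proof.
move=> jl; have [t0|/ltW t0] := leP 0 t.
  rewrite line_ge0// signed_rad_mkT// ger0_norm// eq_sym.
  by case: ifP => // _; rewrite if_same.
rewrite line_le0// signed_rad_mkT ?oppr_ge0// ler0_norm// !opprK (eq_sym j).
by have [->|_] := eqVneq k j; [rewrite (negbTE jl)|rewrite if_same].
Qed.

Lemma rad_signed_rad x : signed_rad (br x) x = rad x.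
Proof. by rewrite /signed_rad eqxx. Qed.

Lemma ler_signed_rad_rad k x : signed_rad k x <= rad x.
Proof. by rewrite /signed_rad; case: ifP => // _; have := rad_ge0 x; lra. Qed.

Lemma signed_rad_inj_pos k x y : 0 < signed_rad k x -> signed_rad k x = signed_rad k y -> x = y.
Proof.
move=> xp xy; rewrite -(mkT_br_rad x) -(mkT_br_rad y).
move: xp xy; rewrite /signed_rad; have := rad_ge0 x; have := rad_ge0 y.
by have [->|_] := eqVneq (br x) k; have [->|_] := eqVneq (br y) k => *; [congr mkT|exfalso; lra..].
Qed.

(* For [c < 0] this fails: the set then lies in the two branches other than [k]
   and omits the origin. *)
Lemma signed_rad_le_convex k c x y lam : 0 <= c -> 0 <= lam <= 1 ->
  signed_rad k x <= c -> signed_rad k y <= c -> signed_rad k (geo x y lam) <= c.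
Proof.
move=> c0 l01; have /andP[l0 l1] := l01.
have [j [l [s [t [jl -> ->]]]]] := common_line x y.
rewrite geo_line// !signed_rad_line//.
case: ifP => _; first by nra.
case: ifP => _; first by nra.
by move=> _ _; apply: le_trans c0; rewrite oppr_le0.
Qed.

Lemma signed_rad_ge_convex k c x y lam : 0 <= c -> 0 <= lam <= 1 ->
  c <= signed_rad k x -> c <= signed_rad k y -> c <= signed_rad k (geo x y lam).
Proof.
move=> c0 l01; have /andP[l0 l1] := l01.
have [j [l [s [t [jl -> ->]]]]] := common_line x y.
rewrite geo_line// !signed_rad_line//.
case: ifP => _; first by nra.
case: ifP => _; first by nra.
have := normr_ge0 s; have := normr_ge0 t => tn sn cs ct.
have /normr0_eq0 -> : `|s| = 0 by lra.
have /normr0_eq0 -> : `|t| = 0 by lra.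
by rewrite !mulr0 addr0 normr0; lra.
Qed.

Lemma signed_rad_geo_lip k x y : exists2 C, 0 < C & forall lam, 0 <= lam <= 1 ->
  `|signed_rad k (geo x y lam) - signed_rad k x| <= lam * C.
Proof.
have [j [l [s [t [jl -> ->]]]]] := common_line x y.
exists (`|t - s| + 1); first by have := normr_ge0 (t - s); lra.
move=> lam /[dup] l01 /andP[l0 l1].
rewrite geo_line// !signed_rad_line//.
have e : `|((1 - lam) * s + lam * t) - s| <= lam * (`|t - s| + 1).
  have -> : (1 - lam) * s + lam * t - s = lam * (t - s) by ring.
  by rewrite normrM ger0_norm//; nra.
case: ifP => _ //; case: ifP => _.
  by rewrite -opprD normrN.
apply: le_trans e; rewrite -opprD normrN.
exact: ler_dist_dist.
Qed.

Section Hull.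
Variables (n : nat) (xs : 'I_n -> T3 R).

Definition hull : set (T3 R) := [set x | forall k c, 0 <= c ->
  ((forall i, signed_rad k (xs i) <= c) -> signed_rad k x <= c) /\
  ((forall i, c <= signed_rad k (xs i)) -> c <= signed_rad k x)].

Lemma hull_data i : hull (xs i).
Proof. by move=> k c c0; split => ->. Qed.

Lemma hull_convex x y lam : 0 <= lam <= 1 -> hull x -> hull y -> hull (geo x y lam).
Proof.
move=> l01 hx hy k c c0; have [x1 x2] := hx k c c0; have [y1 y2] := hy k c c0.
split => h; first by apply: signed_rad_le_convex => //; [exact: x1|exact: y1].
by apply: signed_rad_ge_convex => //; [exact: x2|exact: y2].
Qed.

Lemma hull_between (i0 : 'I_n) x : hull x -> (forall i, x <> xs i) ->
  exists (i j : 'I_n) lam, [/\ 0 < lam < 1, xs i != xs j & x = geo (xs i) (xs j) lam].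
Proof.
move=> hx nx.
have [r0|r0] := eqVneq (rad x) 0.
  have xE := rad_eq0 r0.
  have datap i : 0 < rad (xs i).
    rewrite lt_neqAle rad_ge0 andbT eq_sym; apply/eqP => /rad_eq0 e.
    by apply: (nx i); rewrite e.
  pose k := br (xs i0).
  have [j jP] : exists j : 'I_n, br (xs j) != k.
    apply: contrapT => /forallNP njk.
    have e (j : 'I_n) : br (xs j) = k by apply/eqP; have /negP := njk j; rewrite negbK.
    pose j := [arg min_(j < i0) rad (xs j)]%O.
    have [_ /(_ _)] := hx k (rad (xs j)) (rad_ge0 _).
    have h i : rad (xs j) <= signed_rad k (xs i).
      rewrite /signed_rad e eqxx /j.
      by case: (@Order.TotalTheory.arg_minP _ _ _ i0 xpredT (fun j : 'I_n => rad (xs j))) => // j' _; apply.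
    move=> /(_ h); rewrite /signed_rad r0 oppr0 if_same.
    by have := datap j; lra.
  have ip := datap i0; have jp := datap j.
  exists i0, j, (rad (xs i0) / (rad (xs i0) + rad (xs j))); split.
  - by rewrite divr_gt0 ?addr_gt0//= ltr_pdivrMr ?addr_gt0//; lra.
  - by apply: contra jP => /eqP <-.
  - rewrite -{1}(mkT_br_rad (xs i0)) -{1}(mkT_br_rad (xs j)) geo_diff_branch//; try exact: ltW.
    + rewrite divfK; last by lra.
      by rewrite lexx subrr mkT_le0.
    + by rewrite eq_sym.
    + by rewrite divr_ge0 ?addr_ge0//= ?ler_pdivrMr ?addr_gt0 ?ltW//; lra.
have xp : 0 < rad x by rewrite lt_neqAle eq_sym r0 rad_ge0.
pose k := br x.
have xk : signed_rad k x = rad x by rewrite rad_signed_rad.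
have datan i : signed_rad k (xs i) != rad x.
  by apply/eqP => e; apply: (nx i); apply: (@signed_rad_inj_pos k); rewrite xk.
have [i iP] : exists i, rad x < signed_rad k (xs i).
  pose i := [arg max_(j > i0) signed_rad k (xs j)]%O; exists i.
  have m0 : 0 <= Num.max 0 (signed_rad k (xs i)) by rewrite le_max lexx.
  have [/(_ _) + _] := hx k _ m0.
  rewrite xk lt_neqAle eq_sym datan/= le_max => /(_ _)/orP[|//|//].
    move=> j; rewrite le_max; apply/orP; right; rewrite /i.
    by case: (@Order.TotalTheory.arg_maxP _ _ _ i0 xpredT (fun j : 'I_n => signed_rad k (xs j))) => // j' _; apply.
  by lra.
have [j jP] : exists j : 'I_n, signed_rad k (xs j) < rad x.
  pose j := [arg min_(j < i0) signed_rad k (xs j)]%O; exists j.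
  have [neg|pos] := ltP (signed_rad k (xs j)) 0; first by lra.
  have [_ /(_ _)] := hx k _ pos.
  rewrite xk lt_neqAle datan/=; apply => j'; rewrite /j.
  by case: (@Order.TotalTheory.arg_minP _ _ _ i0 xpredT (fun j : 'I_n => signed_rad k (xs j))) => // j'' _; apply.
exists i, j, ((signed_rad k (xs i) - rad x) / (signed_rad k (xs i) - signed_rad k (xs j))).
have dp : 0 < signed_rad k (xs i) - signed_rad k (xs j) by lra.
set lam := _ / _.
have lamP : 0 < lam < 1 by rewrite divr_gt0//= ?ltr_pdivrMr//; lra.
split => //.
  by apply: contraPneq iP => ->; lra.
have l01 : 0 <= lam <= 1 by lra.
apply: (@signed_rad_inj_pos k); first by rewrite xk.
have [m [mk [s sE]]] : exists m, m != k /\ exists s, xs j = line m k s.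
  have [bj|bj] := eqVneq (br (xs j)) k.
    have [m mk] := other_branch k; exists m; split => //; exists (rad (xs j)).
    by rewrite line_ge0 ?rad_ge0// -bj mkT_br_rad.
  exists (br (xs j)); split => //; exists (- rad (xs j)).
  by rewrite line_le0 ?oppr_le0 ?rad_ge0// opprK mkT_br_rad.
have iE : xs i = line m k (rad (xs i)).
  have bi : br (xs i) = k.
    by apply/eqP; apply: contraLR iP => h; rewrite /signed_rad (negbTE h) -leNgt; have := rad_ge0 (xs i); lra.
  by rewrite line_ge0 ?rad_ge0// -bi mkT_br_rad.
have lE : lam * (signed_rad k (xs i) - signed_rad k (xs j)) = signed_rad k (xs i) - rad x.
  by rewrite /lam divfK//; lra.
move: lE; rewrite iE sE geo_line// !signed_rad_line// eqxx xk; lra.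
Qed.

Lemma hull_initial_avoid x y : ~ hull x -> exists2 tau, 0 < tau <= 1 &
  forall t, 0 <= t <= tau -> ~ hull (geo x y t).
Proof.
move=> /existsNP[k] /existsNP[c] /not_implyP[c0] H.
have [C C0 lip] := signed_rad_geo_lip k x y.
have [d d0 hd] : exists2 d, 0 < d &
    forall z, `|signed_rad k z - signed_rad k x| < d -> ~ hull z.
  move/not_andP : H => [|] /not_implyP[hall /negP hx].
    exists (signed_rad k x - c); first by lra.
    move=> z; rewrite ltr_norml => hz /(_ k c c0)[/(_ hall)] ; lra.
  exists (c - signed_rad k x); first by lra.
  move=> z; rewrite ltr_norml => hz /(_ k c c0)[_ /(_ hall)] ; lra.
exists (Num.min 1 (d / (C + C))).
  by rewrite lt_min ltr01 divr_gt0 ?addr_gt0//= ge_min lexx.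
move=> t /andP[t0]; rewrite le_min => /andP[t1 tC].
apply: hd; apply: le_lt_trans (lip t _) _; first by rewrite t0.
apply: le_lt_trans (_ : t * C <= d / (C + C) * C) _.
  by rewrite ler_wpM2r// ltW.
have -> : d / (C + C) * C = d / 2 by field; lra.
lra.
Qed.

Lemma hull_bounded : exists2 B, 0 < B & forall x, hull x -> rad x <= B.
Proof.
exists (1 + \sum_(i < n) rad (xs i)).
  by rewrite ltr_pwDl// sumr_ge0// => i _; rewrite rad_ge0.
move=> x /(_ (br x) (1 + \sum_(i < n) rad (xs i))); rewrite rad_signed_rad.
case; first by rewrite addr_ge0// sumr_ge0// => i _; rewrite rad_ge0.
move=> + _; apply => i; apply: le_trans (ler_signed_rad_rad _ _) _.
rewrite (bigD1 i)//=.
have : 0 <= \sum_(i0 < n | i0 != i) rad (xs i0) by apply: sumr_ge0 => j _; exact: rad_ge0.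
lra.
Qed.

End Hull.

End Geometry.

(** * Log-concave functions and their mass *)

Section Mass.
Context {R : realType}.
Implicit Types (g h : T3 R -> R) (x y z : T3 R) (k : 'I_3) (r s t c lam tau : R).
Notation mu := (@lebesgue_measure R).
Notation pos := [set r : R | 0 < r].

Definition logconcave g := (forall x, 0 <= g x) /\
  forall x y lam, 0 <= lam <= 1 -> 0 < g x -> 0 < g y ->
    expR ((1 - lam) * ln (g x) + lam * ln (g y)) <= g (geo x y lam).

Lemma elog_geP t c : (c%:E <= elog t)%E <-> expR c <= t.
Proof.
rewrite /elog; case: ifPn => [t0|]; first by split => // h; exfalso; have := expR_gt0 c; lra.
by rewrite -ltNge => t0; rewrite lee_fin -[in X in _ <-> X](lnK t0) ler_expR.
Qed.

Lemma tconcave_elogP g : (forall x, 0 <= g x) ->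
  tconcave (fun x => elog (g x)) <-> logconcave g.
Proof.
move=> g0; split => [gc|[_ gc]].
  split => // x y lam l01 gx gy.
  by apply/elog_geP; apply: gc => //; apply/elog_geP; rewrite lnK.
move=> x y m m' lam /[dup] l01 /andP[l0 l1] /elog_geP mx /elog_geP my; apply/elog_geP.
have gx := lt_le_trans (expR_gt0 m) mx; have gy := lt_le_trans (expR_gt0 m') my.
apply: le_trans (gc x y lam l01 gx gy); rewrite ler_expR.
have : m <= ln (g x) by rewrite -ler_expR lnK.
have : m' <= ln (g y) by rewrite -ler_expR lnK.
by move=> h1 h2; apply: lerD; apply: ler_wpM2l => //; lra.
Qed.

Lemma measurable_pos : measurable (pos : set R).
Proof.
rewrite (_ : pos = `]0, +oo[%classic)//.
by apply/seteqP; split => r /=; rewrite in_itv/= andbT.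
Qed.
Hint Resolve measurable_pos : core.

Definition branchwise_measurable g :=
  forall k, measurable_fun pos (fun r => g (mkT k r)).

Lemma logconcave_measurable g : logconcave g -> branchwise_measurable g.
Proof.
move=> [g0 gc] k.
apply: (measurability (@RGenCInfty.G R)) => [|/= _ [_] [c] -> <-].
  exact: RGenCInfty.measurableE.
apply: is_interval_measurable => s t/= [s0].
rewrite !in_itv/= !andbT => gs [t0] gt u /andP[su ut].
have u0 : 0 < u by lra.
split => //; rewrite in_itv/= andbT.
have [c0|c0] := leP c 0; first exact: le_trans (g0 _).
have [st|st] := eqVneq s t; first by have <- : s = u by lra.
have ts : 0 < t - s by move/eqP: st => st; lra.
pose lam := (u - s) / (t - s).
have l01 : 0 <= lam <= 1.
  by rewrite /lam; apply/andP; split; [apply: divr_ge0; lra|rewrite ler_pdivrMr//; lra].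
have -> : mkT k u = geo (mkT k s) (mkT k t) lam.
  rewrite geo_same_branch//; [|exact: ltW..].
  by congr mkT; rewrite /lam; field; lra.
apply: le_trans (gc _ _ _ l01 _ _); [|exact: lt_le_trans gs|exact: lt_le_trans gt].
have hs : ln c <= ln (g (mkT k s)) by rewrite ler_ln// posrE; exact: lt_le_trans gs.
have ht : ln c <= ln (g (mkT k t)) by rewrite ler_ln// posrE; exact: lt_le_trans gt.
by rewrite -{1}(lnK c0) ler_expR; nra.
Qed.

Lemma F0P g : F0 g <-> logconcave g /\ tint setT g = 1%E.
Proof.
split=> [[[g0 [_ g1]] /(tconcave_elogP g0)]//|[gc g1]].
have g0 := gc.1; split; last exact/tconcave_elogP.
by split => //; split => //; exact: logconcave_measurable.
Qed.

Lemma massE g : tint setT g = (\sum_(k < 3) \int[mu]_(r in pos) (g (mkT k r))%:E)%E.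
Proof.
apply: eq_bigr => k _; congr integral.
by apply/seteqP; split => r //= -[].
Qed.

Let mEFin g k : branchwise_measurable g -> measurable_fun pos (fun r => (g (mkT k r))%:E).
Proof. by move=> mg; apply/measurable_EFinP. Qed.

Lemma mass_ge0 g : (forall x, 0 <= g x) -> (0 <= tint setT g)%E.
Proof.
move=> g0; rewrite massE; apply: sume_ge0 => k _.
by apply: integral_ge0 => r _; rewrite lee_fin.
Qed.

Lemma mass_le g h : (forall x, 0 <= g x) -> branchwise_measurable g ->
  branchwise_measurable h -> (forall x, g x <= h x) -> (tint setT g <= tint setT h)%E.
Proof.
move=> g0 mg mh gh; rewrite !massE; apply: lee_sum => k _.
apply: ge0_le_integral => //; [|exact: mEFin..|].
- by move=> r _; rewrite lee_fin.
- by move=> r _; rewrite lee_fin.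
Qed.

Lemma massZ g c : 0 <= c -> (forall x, 0 <= g x) -> branchwise_measurable g ->
  tint setT (fun x => c * g x) = (c%:E * tint setT g)%E.
Proof.
move=> c0 g0 mg; rewrite !massE ge0_sume_distrr; last first.
  by move=> k _; apply: integral_ge0 => r _; rewrite lee_fin.
apply: eq_bigr => k _; under eq_integral do rewrite EFinM.
by rewrite ge0_integralZl_EFin//; [move=> r _; rewrite lee_fin|exact: mEFin].
Qed.

Lemma massD g h : (forall x, 0 <= g x) -> branchwise_measurable g ->
  (forall x, 0 <= h x) -> branchwise_measurable h ->
  tint setT (fun x => g x + h x) = (tint setT g + tint setT h)%E.
Proof.
move=> g0 mg h0 mh; rewrite !massE -big_split/=.
apply: eq_bigr => k _; under eq_integral do rewrite EFinD.
by rewrite ge0_integralD//; [|exact: mEFin| |exact: mEFin]; move=> r _; rewrite lee_fin.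
Qed.

Definition null_set (N : set (T3 R)) := forall k, mu.-negligible (trace N k).

Lemma mass_eq0 g : (forall x, 0 <= g x) -> branchwise_measurable g ->
  tint setT g = 0%E -> null_set [set x | g x != 0].
Proof.
move=> g0 mg; rewrite massE => g1 k.
have ik j : (0 <= \int[mu]_(r in pos) (g (mkT j r))%:E)%E.
  by apply: integral_ge0 => r _; rewrite lee_fin.
have h : (\int[mu]_(r in pos) `|(g (mkT k r))%:E|)%E = 0%E.
  under eq_integral do rewrite gee0_abs ?lee_fin//.
  apply/eqP; rewrite eq_le ik andbT -g1 (bigD1 k)//= leeDl//.
  by apply: sume_ge0.
move/ae_eq_integral_abs : h => /(_ measurable_pos (mEFin k mg)).
apply: negligibleS => r /= [r0 gr] /(_ r0) [e].
by move: gr; rewrite /= e eqxx.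
Qed.

Lemma geo_contains_interval x y : x != y -> exists k, exists2 kappa : R, 0 < kappa &
  forall tau, 0 < tau <= 1 -> exists u v, [/\ u < v, v - u = kappa * tau &
    forall r, u < r < v -> 0 < r /\ exists2 t, 0 < t < tau & mkT k r = geo x y t].
Proof.
move=> xy; have [k [a [b [lam [a0 b0 ab /andP[l0 l1] geoE]]]]] := geo_initial_branch xy.
exists k, `|b - a|; first by rewrite normr_gt0 subr_eq0 eq_sym.
move=> tau /andP[tau0 tau1].
pose e := a + tau * (b - a); exists (Num.min a e), (Num.max a e).
have eE : Num.max a e - Num.min a e = `|b - a| * tau.
  have -> : `|b - a| * tau = `|e - a|.
    by rewrite /e addrAC subrr add0r normrM ger0_norm 1?mulrC// ltW.
  by case: (ltP a e) => ae; [rewrite ger0_norm|rewrite ler0_norm]; lra.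
have bap : 0 < `|b - a| by rewrite normr_gt0 subr_eq0 eq_sym.
have kp : 0 < `|b - a| * tau by rewrite mulr_gt0.
split => //; first by lra.
move=> r /andP[r1 r2]; pose t := (r - a) / (b - a).
have [t0 rp] : 0 < t < tau /\ 0 < r.
  have [ba|ba] := ltP a b.
    have ae' : a <= e by rewrite /e; nra.
    move: r1 r2; rewrite min_l// max_r// /e => r1 r2; split; last by lra.
    by rewrite /t divr_gt0 ?subr_gt0//= ltr_pdivrMr ?subr_gt0//; lra.
  have ba' : b < a by rewrite lt_neqAle eq_sym ab.
  have ae' : e <= a by rewrite /e; nra.
  move: r1 r2; rewrite min_r// max_l// /e => r1 r2; split; last by nra.
  rewrite /t -mulrNN -invrN !opprB divr_gt0 ?subr_gt0//= ltr_pdivrMr ?subr_gt0//; nra.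
split => //; exists (lam * t); first by apply/andP; split; nra.
rewrite geoE; last by lra.
by congr mkT; rewrite /t; field; move/eqP : ab; lra.
Qed.

Lemma null_geo N x y tau : null_set N -> x != y -> 0 < tau <= 1 ->
  exists2 t, 0 < t < tau & ~ N (geo x y t).
Proof.
move=> Nnull xy tau01; apply: contrapT => H.
have {}H t : 0 < t < tau -> N (geo x y t).
  by move=> t0; apply: contrapT => nN; apply: H; exists t.
have [k [kappa kp /(_ _ tau01)[u [v [uv _ uvP]]]]] := geo_contains_interval xy.
have : mu (`]u, v[%classic : set R) = 0%E.
  apply: measure_negligible; first exact: measurable_itv.
  apply: negligibleS (Nnull k) => r; rewrite /= in_itv/= => /uvP[r0 [t t0 e]].
  by split => //; rewrite e; exact: H.
rewrite lebesgue_measure_itv/= lte_fin uv -EFinB => -[]; lra.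
Qed.

Lemma mass_geo_ge x y : x != y -> exists2 kappa, 0 < kappa &
  forall g c tau, (forall z, 0 <= g z) -> branchwise_measurable g -> 0 <= c -> 0 < tau <= 1 ->
    (forall t, 0 <= t <= tau -> c <= g (geo x y t)) ->
    ((kappa * tau * c)%:E <= tint setT g)%E.
Proof.
move=> xy; have [k [kappa kp H]] := geo_contains_interval xy.
exists kappa => // g c tau g0 mg c0 tau01 gc.
have [u [v [uv uvE uvP]]] := H _ tau01.
pose J : set R := `]u, v[%classic.
have Jsub r : J r -> 0 < r /\ c <= g (mkT k r).
  rewrite /J /= in_itv/= => /uvP[r0 [t t0 ->]]; split => //.
  by apply: gc; lra.
have mJ : measurable J by exact: measurable_itv.
have ik j : (0 <= \int[mu]_(r in pos) (g (mkT j r))%:E)%E.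
  by apply: integral_ge0 => r _; rewrite lee_fin.
rewrite massE (bigD1 k)//=.
apply: (@le_trans _ _ (\int[mu]_(r in pos) (g (mkT k r))%:E)%E); last first.
  by rewrite leeDl//; apply: sume_ge0.
apply: (@le_trans _ _ (\int[mu]_(r in J) (g (mkT k r))%:E)%E); last first.
  apply: ge0_subset_integral => //; [exact: mEFin|by move=> r _; rewrite lee_fin|].
  by move=> r /Jsub[].
apply: (@le_trans _ _ (\int[mu]_(r in J) (cst c%:E r))%E); last first.
  apply: ge0_le_integral => //.
  - by apply: measurable_funS (mEFin k mg) => // r /Jsub[].
  - by move=> r /Jsub[]; rewrite lee_fin.
have mJE : mu J = (kappa * tau)%:E.
  by rewrite /J lebesgue_measure_itv/= lte_fin uv -EFinB uvE.
rewrite integral_cst//; set m := (X in (_ * X)%E).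
have -> : m = (kappa * tau)%:E by exact: mJE.
by rewrite -EFinM lee_fin mulrC.
Qed.

Lemma mass_lty g M B : (forall x, 0 <= g x) -> branchwise_measurable g ->
  (forall x, g x <= M) -> (forall x, B < rad x -> g x = 0) -> (tint setT g < +oo)%E.
Proof.
move=> g0 mg gM gB; rewrite massE.
apply: lte_sum_pinfty => k _.
have M0 : 0 <= M by apply: le_trans (g0 (orig R)) (gM _).
apply: (@le_lt_trans _ _ (\int[mu]_(r in pos) (M%:E * (\1_(`]0, B] : set R) r)%:E))%E).
  apply: ge0_le_integral => //.
  - by move=> r _; rewrite lee_fin.
  - exact: mEFin.
  - by apply/measurable_EFinP; apply: measurable_funM.
  - move=> r r0; rewrite -EFinM lee_fin indicE.
    have [rB|rB] := leP r B.
      by rewrite mem_set ?mulr1//= in_itv/= rB andbT.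
    by rewrite gB ?rad_mkT// mulr_ge0.
rewrite ge0_integralZl_EFin//; last by apply/measurable_EFinP; exact: measurable_indic.
rewrite integral_indic// lte_mul_pinfty ?lee_fin//.
apply: (@le_lt_trans _ _ (mu `]0, B]%classic)).
  by apply: le_measure; rewrite ?inE//; apply: measurableI.
rewrite lebesgue_measure_itv/=; case: ifP => _; by rewrite ?ltry.
Qed.

End Mass.

(** * Existence *)

Section LogConcaveOperations.
Context {R : realType}.
Implicit Types (g h : T3 R -> R) (x y z : T3 R) (c lam : R).

Lemma logconcave_cst c : 0 <= c -> logconcave (fun _ : T3 R => c).
Proof.
move=> c0; split => // x y lam _ cp _.
by rewrite -mulrDl subrK mul1r lnK.
Qed.

Lemma logconcaveZ c g : 0 < c -> logconcave g -> logconcave (fun x => c * g x).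
Proof.
move=> c0 [g0 gc]; split=> [x|x y lam l01]; first by rewrite mulr_ge0// ltW.
rewrite !pmulr_rgt0// => gx gy; rewrite !lnM ?posrE//.
have -> : (1 - lam) * (ln c + ln (g x)) + lam * (ln c + ln (g y)) =
  ln c + ((1 - lam) * ln (g x) + lam * ln (g y)) by ring.
by rewrite expRD lnK// ler_pM2l//; exact: gc.
Qed.

Lemma logconcave_restrict (A : set (T3 R)) g :
  (forall x y lam, 0 <= lam <= 1 -> A x -> A y -> A (geo x y lam)) ->
  logconcave g -> logconcave (fun x => g x * \1_A x).
Proof.
move=> Ac [g0 gc]; split=> [x|x y lam l01]; first by rewrite mulr_ge0.
rewrite !indicE.
have [Ax|] := boolP (x \in A); last by rewrite mulr0 ltxx.
have [Ay|] := boolP (y \in A); last by rewrite mulr0 ltxx.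
rewrite !mulr1 => gx gy.
rewrite mem_set ?mulr1; first exact: gc.
by apply: Ac => //; exact: set_mem.
Qed.

End LogConcaveOperations.

Section Existence.
Context {R : realType} (n : nat) (xs : 'I_n -> T3 R).
Hypothesis xs_distinct : exists i j, xs i != xs j.
Implicit Types (y : 'I_n -> R) (g h : T3 R -> R) (x : T3 R) (a b c d lam : R).

Definition majorant y : set (T3 R -> R) :=
  [set g | logconcave g /\ forall i, expR (y i) <= g (xs i)].

Definition tent y x : R := inf [set g x | g in majorant y].

Lemma majorant_hull y b : (forall i, y i <= b) ->
  majorant y (fun x => expR b * \1_(hull xs) x).
Proof.
move=> yb; split.
  apply: logconcave_restrict; first by move=> *; exact: hull_convex.
  exact/logconcave_cst/expR_ge0.
by move=> i; rewrite indicE mem_set ?mulr1 ?ler_expR//; exact: hull_data.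
Qed.

Lemma majorant_neq0 y : exists g, majorant y g.
Proof.
eexists; apply: (@majorant_hull y (\sum_i `|y i|)) => i.
by rewrite (bigD1 i)//= (le_trans (ler_norm _))// lerDl sumr_ge0.
Qed.

Lemma tent_le y g x : majorant y g -> tent y x <= g x.
Proof.
move=> yg; apply: ge_inf; last by exists g.
by exists 0 => _ [h [[h0 _] _] <-].
Qed.

Lemma le_tent y c x : (forall g, majorant y g -> c <= g x) -> c <= tent y x.
Proof.
move=> H; apply: lb_le_inf; last by move=> _ [g yg <-]; exact: H.
by have [g yg] := majorant_neq0 y; exists (g x); exists g.
Qed.

Lemma tent_ge0 y x : 0 <= tent y x.
Proof. by apply: le_tent => g [[]]. Qed.

Lemma tent_data y i : expR (y i) <= tent y (xs i).
Proof. by apply: le_tent => g []. Qed.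

Lemma tent_logconcave y : logconcave (tent y).
Proof.
split=> [x|x x' lam /[dup] l01 /andP[l0 l1] tx tx']; first exact: tent_ge0.
apply: le_tent => g /[dup] yg [[_ gc] _].
have gx : tent y x <= g x by exact: tent_le.
have gx' : tent y x' <= g x' by exact: tent_le.
have px := lt_le_trans tx gx; have px' := lt_le_trans tx' gx'.
apply: le_trans (gc _ _ _ l01 px px'); rewrite ler_expR lerD// ler_wpM2l ?subr_ge0//.
  by rewrite ler_ln ?posrE.
by rewrite ler_ln ?posrE.
Qed.

Lemma tent_measurable y : branchwise_measurable (tent y).
Proof. by apply: logconcave_measurable; exact: tent_logconcave. Qed.

Lemma tent_geo y i j lam : 0 <= lam <= 1 ->
  expR ((1 - lam) * y i + lam * y j) <= tent y (geo (xs i) (xs j) lam).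
Proof.
move=> /[dup] l01 /andP[l0 l1]; have [_ tc] := tent_logconcave y.
have p k : 0 < tent y (xs k) by exact: lt_le_trans (expR_gt0 _) (tent_data y k).
apply: le_trans (tc _ _ _ l01 (p i) (p j)); rewrite ler_expR.
have q k : y k <= ln (tent y (xs k)) by rewrite -ler_expR lnK ?posrE ?p ?tent_data.
by rewrite lerD// ler_wpM2l ?subr_ge0.
Qed.

Lemma tent_shift y y' d x : (forall i, y' i <= y i + d) ->
  tent y' x <= expR d * tent y x.
Proof.
move=> yd; rewrite -ler_pdivrMl ?expR_gt0//; apply: le_tent => g [gl yg].
rewrite ler_pdivrMl ?expR_gt0//.
apply: (@tent_le _ (fun x => expR d * g x)); split.
  by apply: logconcaveZ => //; exact: expR_gt0.
move=> i; apply: (@le_trans _ _ (expR (y i + d))); first by rewrite ler_expR.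
by rewrite addrC expRD ler_pM2l ?expR_gt0.
Qed.

Lemma tent_mass_lty y : (tint setT (tent y) < +oo)%E.
Proof.
have [B B0 hB] := hull_bounded xs.
pose b := \sum_i `|y i|.
have yb : majorant y (fun x => expR b * \1_(hull xs) x).
  apply: majorant_hull => i.
  by rewrite /b (bigD1 i)//= (le_trans (ler_norm _))// lerDl sumr_ge0.
apply: (@mass_lty _ _ (expR b) B); [exact: tent_ge0|exact: tent_measurable| |].
  move=> x; apply: le_trans (tent_le x yb) _.
  by rewrite indicE; case: (_ \in _); rewrite ?mulr1 ?mulr0 ?expR_ge0.
move=> x xB; apply/eqP; rewrite eq_le tent_ge0 andbT.
apply: le_trans (tent_le x yb) _; rewrite indicE memNset ?mulr0//.
by move=> /hB; lra.
Qed.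

Lemma tent_mass_gt0 y : (0 < tint setT (tent y))%E.
Proof.
have [i [j ij]] := xs_distinct; have [kappa k0 H] := mass_geo_ge ij.
pose c := expR (- (`|y i| + `|y j|)).
have := H (tent y) c 1 (tent_ge0 y) (tent_measurable y) (expR_ge0 _).
rewrite ltr01 lexx mulr1 => /(_ isT)h.
apply: lt_le_trans (h _); first by rewrite lte_fin mulr_gt0// expR_gt0.
move=> t /[dup] t01 /andP[t0 t1]; apply: le_trans (tent_geo _ _ _ t01).
rewrite ler_expR; have := ler_norm (- y i); have := ler_norm (- y j).
have := normr_ge0 (y i); have := normr_ge0 (y j).
rewrite !normrN; nra.
Qed.

Lemma tent_logmass_exists y : {l : R | tint setT (tent y) = (expR l)%:E}.
Proof.
exists (ln (fine (tint setT (tent y)))).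
have mp := tent_mass_gt0 y; rewrite lnK ?posrE; last first.
  by rewrite fine_gt0// mp tent_mass_lty.
by rewrite fineK// ge0_fin_numE ?tent_mass_lty// ltW.
Qed.

(* Behind an opaque proof, so that unification does not unfold [ln] and the
   integral when comparing two such terms. *)
Definition tent_logmass y : R := sval (tent_logmass_exists y).

Lemma tent_logmassE y : tint setT (tent y) = (expR (tent_logmass y))%:E.
Proof. exact: (svalP (tent_logmass_exists y)). Qed.

Lemma tent_logmass_shift y y' d : (forall i, y' i <= y i + d) ->
  tent_logmass y' <= d + tent_logmass y.
Proof.
move=> yd; suff : (tint setT (tent y') <= (expR d)%:E * tint setT (tent y))%E.
  by rewrite (tent_logmassE y') (tent_logmassE y) -EFinM lee_fin -expRD ler_expR.
rewrite -massZ ?expR_ge0//; [|exact: tent_ge0|exact: tent_measurable].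
apply: mass_le; [exact: tent_ge0|exact: tent_measurable| |by move=> x; exact: tent_shift].
by apply: logconcave_measurable; apply: logconcaveZ; [exact: expR_gt0|exact: tent_logconcave].
Qed.

(* The log-likelihood of the density obtained by normalising [tent y], up to the
   slack in [expR (y i) <= tent y (xs i)]. *)
Definition score y : R := \sum_i y i - n%:R * tent_logmass y.

Lemma score_shift y d : score (fun i => y i + d) = score y.
Proof.
rewrite /score; have -> : tent_logmass (fun i => y i + d) = d + tent_logmass y.
  apply/eqP; rewrite eq_le tent_logmass_shift//=.
  have := @tent_logmass_shift (fun i => y i + d) y (- d).
  by move=> /(_ _); rewrite -lerBlDl opprK addrC; apply => i; lra.
rewrite big_split/= sumr_const card_ord -mulr_natl; ring.
Qed.

Lemma score_lip y y' d : (forall i, `|y i - y' i| <= d) ->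
  score y <= score y' + 2 * n%:R * d.
Proof.
move=> yd; have yy i : y i <= y' i + d by have := yd i; rewrite ler_norml; lra.
have yy' i : y' i <= y i + d by have := yd i; rewrite ler_norml; lra.
have h := tent_logmass_shift yy'.
have s : \sum_i y i <= \sum_i y' i + n%:R * d.
  rewrite -[X in _ <= _ + X](_ : \sum_(i < n) d = _).
    by rewrite -big_split/=; apply: ler_sum.
  by rewrite sumr_const card_ord mulr_natl.
rewrite /score; have : n%:R * tent_logmass y' <= n%:R * (d + tent_logmass y).
  by rewrite ler_wpM2l.
have arith (N S S' l l' e : R) : S <= S' + N * e -> N * l' <= N * (e + l) ->
  S - N * l <= S' - N * l' + 2 * N * e by clear; lra.
exact: arith.
Qed.

Lemma ln_le_sub1 a : 0 < a -> ln a <= a - 1.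
Proof. by move=> a0; have := @le_ln1Dx R (a - 1); rewrite [1 + _]addrC subrK; apply; lra. Qed.

Lemma score_coercive : exists2 B, 0 < B & forall y i, y i = 0 ->
  (forall j, y j <= 0) -> (exists j, y j < - B) -> score y <= score (fun=> 0).
Proof.
have n0 : 0 < n%:R :> R.
  by have [i _] := xs_distinct; rewrite ltr0n; apply: leq_ltn_trans (ltn_ord i).
suff : forall i, exists B, 1 <= B /\ forall y, y i = 0 ->
  (forall j, y j <= 0) -> (exists j, y j < - B) -> score y <= score (fun=> 0).
  move=> /choice[B BP]; exists (1 + \sum_i B i).
    by rewrite ltr_pwDl// sumr_ge0// => i _; have [] := BP i; lra.
  move=> y i yi yj [j yB]; apply: (BP i).2 => //; exists j; apply: lt_le_trans yB _.
  rewrite lerN2 (bigD1 i)//= addrCA lerDl addr_ge0// sumr_ge0// => k _.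
  by have [] := BP k; lra.
move=> i.
have [p ip] : exists p, xs i != xs p.
  have [j [k jk]] := xs_distinct; have [ij|ij] := eqVneq (xs i) (xs j); last by exists j.
  by exists k; rewrite ij.
have [kappa k0 H] := mass_geo_ge ip.
pose C := n%:R * (ln (2 * n%:R) + 1 - ln kappa).
exists (Num.max 1 (2 * (C - score (fun=> 0)))); split; first by rewrite le_max lexx.
move=> y yi y0 [j0 yj0].
pose j := [arg min_(j < i) y j]%O.
have yj k : y j <= y k.
  by rewrite /j; case: (@Order.TotalTheory.arg_minP _ _ _ i xpredT y) => // j' _; apply.
pose u := - y j; have : Num.max 1 (2 * (C - score (fun=> 0))) < u.
  by rewrite /u ltrNr; apply: le_lt_trans (yj j0) _.
rewrite gt_max => /andP[u1 uC].
have u0 : 0 < u by lra.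
have K1 : kappa / u * expR (-1) <= expR (tent_logmass y).
  rewrite -lee_fin -tent_logmassE; apply: H; [exact: tent_ge0|exact: tent_measurable|exact: expR_ge0| |].
    by rewrite invr_gt0 u0 invf_le1// ltW.
  move=> t /andP[t0 tu]; have tu1 : t * u <= 1 by rewrite -ler_pdivlMr// mul1r.
  have t1 : t <= 1 by nra.
  apply: le_trans (@tent_geo y i p t _); last by rewrite t0.
  by rewrite ler_expR yi mulr0 add0r; have := yj p; rewrite -/u /u in tu1 *; nra.
have K2 : ln kappa - ln u - 1 <= tent_logmass y.
  rewrite -ler_expR; apply: le_trans K1.
  by rewrite !expRD lnK// expRN lnK.
have S1 : \sum_k y k <= - u.
  by rewrite (bigD1 j)//= opprK gerDl sumr_le0.
have n2 : 0 < 2 * n%:R :> R by lra.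
have lnu : n%:R * ln u <= u / 2 + n%:R * ln (2 * n%:R).
  have := @ln_le_sub1 (u / (2 * n%:R)) (divr_gt0 u0 n2).
  rewrite ln_div ?posrE// => h.
  have : n%:R * (ln u - ln (2 * n%:R)) <= n%:R * (u / (2 * n%:R) - 1) by rewrite ler_pM2l.
  have -> : n%:R * (u / (2 * n%:R) - 1) = u / 2 - n%:R by field; lra.
  lra.
have K3 : n%:R * (ln kappa - ln u - 1) <= n%:R * tent_logmass y by rewrite ler_pM2l.
move: uC; rewrite /C [score y]/score; lra.
Qed.

Lemma score_max : exists y, forall y', score y' <= score y.
Proof.
have [i0 _] := xs_distinct.
have [B B0 coer] := score_coercive.
pose A : set 'rV[R]_n := [set v | forall i, `[- B, 0]%classic (v ord0 i)].
pose f (v : 'rV[R]_n) := score (fun i => v ord0 i).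
have A0 : A 0 by move=> i; rewrite /= mxE in_itv/= lexx oppr_le0 ltW.
have cA : compact A by apply: (@rV_compact R n (fun=> `[- B, 0]%classic)) => i; exact: segment_compact.
have cf : continuous f.
  move=> v; apply/(@cvgrPdist_lt _ _ _ _ (nbhs_filter v)) => e e0.
  have n1 : 0 < 2 * n%:R + 1 :> R by rewrite ltr_wpDl.
  apply/nbhs_ballP; exists (e / (2 * n%:R + 1)); first exact: divr_gt0.
  move=> w vw; set d := e / _ in vw.
  have d0 : 0 < d by exact: divr_gt0.
  have dE : 2 * n%:R * d + d = e by rewrite /d; field; lra.
  have vwd i : `|v ord0 i - w ord0 i| <= d by apply/ltW; exact: (vw.2 ord0 i).
  have wvd i : `|w ord0 i - v ord0 i| <= d by rewrite distrC.
  have arith (S S' D d' E : R) : S <= S' + D -> S' <= S + D -> D + d' = E ->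
    0 < d' -> - E < S - S' < E by clear; lra.
  rewrite ltr_norml.
  exact: (arith _ _ _ _ _ (score_lip vwd) (score_lip wvd) dE d0).
have [v vA vmax] := EVT_max_rV (ex_intro _ _ A0) cA (continuous_subspaceT cf).
exists (fun i => v ord0 i) => y.
pose m := [arg max_(j > i0) y j]%O.
have ym k : y k <= y m.
  by rewrite /m; case: (@Order.TotalTheory.arg_maxP _ _ _ i0 xpredT y) => // j' _; apply.
pose y' i := y i + - y m.
have rowE (z : 'I_n -> R) : score z = f (\row_i z i).
  by rewrite /f; congr score; apply/funext => i; rewrite mxE.
rewrite -(score_shift y (- y m)) -/y'.
have [[j yj]|nj] := pselect (exists j, y' j < - B).
  apply: le_trans (coer y' m _ _ _) _; rewrite /y'; [by lra|by move=> k; have := ym k; lra|by exists j|].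
  rewrite rowE; apply: vmax; apply/mem_set => i.
  by rewrite /= mxE in_itv/= lexx oppr_le0 ltW.
rewrite rowE; apply: vmax; apply/mem_set => i.
rewrite /= mxE in_itv/= /y'; have := ym i => ymi.
apply/andP; split; last by lra.
by rewrite leNgt; apply/negP => h; apply: nj; exists i.
Qed.

Lemma loglik_pos g : (forall i, 0 < g (xs i)) ->
  loglik xs g = (\sum_i ln (g (xs i)))%:E.
Proof.
move=> gp; rewrite /loglik -sumEFin; apply: eq_bigr => i _.
by rewrite /elog leNgt gp.
Qed.

Lemma loglik_npos g i : g (xs i) <= 0 -> loglik xs g = -oo%E.
Proof.
move=> gi; apply/esum_eqNyP; exists i; split => //.
by rewrite /elog gi.
Qed.

Lemma F0_normalize g c : logconcave g -> 0 < c -> tint setT g = c%:E ->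
  F0 (fun x => c^-1 * g x).
Proof.
move=> gl c0 gc; apply/F0P; split; first by apply: logconcaveZ; rewrite ?invr_gt0.
rewrite massZ ?invr_ge0 ?(ltW c0)//; [|exact: gl.1|exact: logconcave_measurable].
by rewrite gc -EFinM mulVf// gt_eqF.
Qed.

Lemma loglik_normalize g c : (forall i, 0 < g (xs i)) -> 0 < c ->
  loglik xs (fun x => c^-1 * g x) = (\sum_i ln (g (xs i)) - n%:R * ln c)%:E.
Proof.
move=> gp c0; rewrite loglik_pos; last by move=> i; rewrite mulr_gt0 ?invr_gt0.
have -> : n%:R * ln c = \sum_(i < n) ln c by rewrite sumr_const card_ord mulr_natl.
congr EFin; rewrite -sumrB.
by apply: eq_bigr => i _; rewrite lnM ?posrE ?invr_gt0// lnV ?posrE// addrC.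
Qed.

Lemma mle_exists : exists g, is_mle xs g.
Proof.
have [y ymax] := score_max.
have tp z i : 0 < tent z (xs i) by exact: lt_le_trans (expR_gt0 _) (tent_data z i).
exists (fun x => (expR (tent_logmass y))^-1 * tent y x); split.
  by apply: F0_normalize; [exact: tent_logconcave|exact: expR_gt0|exact: tent_logmassE].
move=> h /F0P[hl h1].
have [hp|/existsNP[i /negP]] := pselect (forall i, 0 < h (xs i)); last first.
  by rewrite -leNgt => /loglik_npos ->; rewrite leNye.
rewrite loglik_normalize ?expR_gt0// loglik_pos// lee_fin expRK.
pose z i := ln (h (xs i)).
have zh : majorant z h by split => // i; rewrite /z lnK ?posrE.
have z1 : tent_logmass z <= 0.
  rewrite -ler_expR expR0 -lee_fin -tent_logmassE -h1; apply: mass_le.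
  - exact: tent_ge0.
  - exact: tent_measurable.
  - exact: logconcave_measurable.
  - by move=> x; exact: tent_le.
apply: (@le_trans _ _ (score z)); first by rewrite /score lerDl oppr_ge0 mulr_ge0_le0.
apply: le_trans (ymax z) _; rewrite /score lerD2r; apply: ler_sum => i _.
by rewrite -ler_expR lnK ?tent_data// posrE.
Qed.

Lemma mle_gt0 g : is_mle xs g -> forall i, 0 < g (xs i).
Proof.
move=> [/F0P[[g0 _] _] gmax] i; rewrite ltNge; apply/negP => /loglik_npos gN.
have tp k : 0 < tent (fun=> 0) (xs k) by exact: lt_le_trans (expR_gt0 _) (tent_data _ k).
have := gmax _ (F0_normalize (tent_logconcave _) (expR_gt0 _) (tent_logmassE (fun=> 0))).
by rewrite gN leeNy_eq loglik_normalize// expR_gt0.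
Qed.

End Existence.

(** * Uniqueness *)

Section ConcaveOnUnitInterval.
Context {R : realType}.
Implicit Types (a b : R -> R) (s t m lam tau : R).

Definition concave01 a := forall s t lam, 0 <= s <= 1 -> 0 <= t <= 1 -> 0 <= lam <= 1 ->
  (1 - lam) * a s + lam * a t <= a ((1 - lam) * s + lam * t).

Definition densely_equal a b := forall s t, 0 <= s -> s < t -> t <= 1 ->
  exists2 r, s < r < t & a r = b r.

Lemma concave01_three a s m t : concave01 a -> 0 <= s -> s < m -> m < t -> t <= 1 ->
  (t - m) * a s + (m - s) * a t <= (t - s) * a m.
Proof.
move=> ac s0 sm mt t1; pose mu := (m - s) / (t - s).
have ts : 0 < t - s by lra.
have muE : mu * (t - s) = m - s by rewrite /mu divfK//; lra.
have mu01 : 0 <= mu <= 1.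
  by rewrite /mu; apply/andP; split; [apply: divr_ge0; lra|rewrite ler_pdivrMr//; lra].
have := ac s t mu; rewrite (_ : (1 - mu) * s + mu * t = m); last by lra.
move=> /(_ _ _ mu01) h.
have {}h : (1 - mu) * a s + mu * a t <= a m by apply: h; lra.
have : (t - s) * ((1 - mu) * a s + mu * a t) <= (t - s) * a m by rewrite ler_pM2l.
have -> : (t - s) * ((1 - mu) * a s + mu * a t) =
  (t - s - mu * (t - s)) * a s + mu * (t - s) * a t by ring.
by rewrite muE; lra.
Qed.

Lemma le_of_small_error (c C : R) : (forall tau, 0 < tau < 1 -> exists2 s, 0 < s < tau & c <= s * C) ->
  c <= 0.
Proof.
move=> H; rewrite leNgt; apply/negP => c0.
have [C0|C0] := leP C 0.
  by have [s /andP[s0 _]] := H (1 / 2) ltac:(lra); nra.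
have [|s /andP[s0 st]] := H (Num.min (1 / 2) (c / C)).
  by rewrite lt_min gt_min !divr_gt0//=; apply/orP; left; lra.
move: st; rewrite lt_min => /andP[_]; rewrite ltr_pdivlMr//; lra.
Qed.

Lemma densely_equal_le_interior a b lam : concave01 a -> concave01 b ->
  densely_equal a b -> 0 < lam < 1 -> b lam <= a lam.
Proof.
move=> ac bc ab /andP[l0 l1].
have [t2 /andP[lt2 t21] _] := ab lam 1 (ltW l0) l1 (lexx 1).
suff : (t2 - lam) * (b lam - a lam) <= 0 by rewrite pmulr_rle0 ?subr_gt0// subr_le0.
apply: (@le_of_small_error _ ((t2 - lam) * (b lam - b 0) + lam * (a lam - a t2))).
move=> tau /andP[tau0 tau1].
have [t /andP[t0 t1] tE] := ab ((1 - tau) * lam) lam ltac:(nra) ltac:(nra) (ltW l1).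
pose s := (lam - t) / lam.
have sE : s * lam = lam - t by rewrite /s divfK//; lra.
have s0 : 0 < s by rewrite /s divr_gt0//; lra.
have st : s < tau by rewrite /s ltr_pdivrMr//; lra.
exists s; first by rewrite s0.
have h1 : (t2 - lam) * a t + (lam - t) * a t2 <= (t2 - t) * a lam.
  by apply: concave01_three => //; nra.
have h2 : (1 - s) * b lam + s * b 0 <= b t.
  have := bc lam 0 s; rewrite (_ : (1 - s) * lam + s * 0 = t); last by lra.
  by apply; lra.
have h3 : (t2 - lam) * ((1 - s) * b lam + s * b 0) <= (t2 - lam) * a t.
  by rewrite ler_pM2l ?subr_gt0// tE.
move: h1 h3; rewrite -sE (_ : t2 - t = (t2 - lam) + s * lam); last by lra.
move=> h1 h3; nra.
Qed.

Lemma densely_equal_chordl a b lam : concave01 a -> concave01 b ->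
  densely_equal a b -> 0 < lam < 1 -> (1 - lam) * b 0 + lam * a 1 <= a lam.
Proof.
move=> ac bc ab /andP[l0 l1].
rewrite -subr_le0; apply: (@le_of_small_error _ ((1 - lam) * (b 0 - b 1) + a 1 - a lam)).
move=> tau /andP[tau0 tau1].
have m0 : 0 < Num.min tau lam by rewrite lt_min tau0.
have m1 : Num.min tau lam <= 1 by rewrite ge_min (ltW l1) orbT.
have [s /andP[s0 sm] sE] := ab 0 _ (lexx 0) m0 m1.
move: sm; rewrite lt_min => /andP[stau sl].
exists s; first by rewrite s0.
have h1 : (1 - lam) * a s + (lam - s) * a 1 <= (1 - s) * a lam.
  by apply: concave01_three => //; lra.
have h2 : (1 - s) * b 0 + s * b 1 <= b s.
  have := bc 0 1 s; rewrite (_ : (1 - s) * 0 + s * 1 = s); last by lra.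
  by apply; lra.
have h3 : (1 - lam) * ((1 - s) * b 0 + s * b 1) <= (1 - lam) * a s.
  by rewrite ler_pM2l ?subr_gt0// sE.
nra.
Qed.

Lemma concave01_rev a : concave01 a -> concave01 (fun t => a (1 - t)).
Proof.
move=> ac s t lam s01 t01 l01.
rewrite (_ : 1 - ((1 - lam) * s + lam * t) = (1 - lam) * (1 - s) + lam * (1 - t)); last by ring.
by apply: ac => //; lra.
Qed.

Lemma densely_equal_max_chord a b lam : concave01 a -> concave01 b ->
  densely_equal a b -> 0 < lam < 1 ->
  (1 - lam) * Num.max (a 0) (b 0) + lam * Num.max (a 1) (b 1) <= a lam.
Proof.
move=> ac bc ab l01; have /andP[l0 l1] := l01.
have chord (c : R -> R) : concave01 c -> (1 - lam) * c 0 + lam * c 1 <= c lam.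
  move=> cc; have := cc 0 1 lam; rewrite mulr0 add0r mulr1; apply; lra.
case: (leP (a 0) (b 0)) => h0; case: (leP (a 1) (b 1)) => h1.
- exact: le_trans (chord b bc) (densely_equal_le_interior ac bc ab l01).
- exact: densely_equal_chordl.
- have := @densely_equal_chordl _ _ (1 - lam) (concave01_rev ac) (concave01_rev bc).
  rewrite /= subr0 subrr !subKr [lam * _ + _]addrC => h; apply: h; last by lra.
  move=> s t s0 st t1.
  have [r rst rE] := ab (1 - t) (1 - s) ltac:(lra) ltac:(lra) ltac:(lra).
  by exists (1 - r); [lra|rewrite subKr].
- exact: chord.
Qed.

End ConcaveOnUnitInterval.

Section AlmostEqual.
Context {R : realType}.
Implicit Types (g h : T3 R -> R) (x y z : T3 R) (t lam : R).

Lemma geo_inj x y s t : 0 <= s <= 1 -> 0 <= t <= 1 -> s < t -> x != y ->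
  geo x y s != geo x y t.
Proof.
move=> s01 t01 st; have [j [l [u [v [jl -> ->]]]]] := common_line x y => uv.
rewrite !geo_line//; apply/eqP => /(congr1 (signed_rad l)).
rewrite !signed_rad_line// eqxx => e.
have : (t - s) * (v - u) = 0 by lra.
move/eqP; rewrite mulf_eq0 => /orP[|/eqP vu]; first by rewrite subr_eq0 gt_eqF.
by move/eqP: uv; apply; congr line; lra.
Qed.

Lemma logconcave_geo_gt0 g x y t : logconcave g -> 0 <= t <= 1 -> 0 < g x -> 0 < g y ->
  0 < g (geo x y t).
Proof. by move=> [_ gc] t01 gx gy; apply: lt_le_trans (gc _ _ _ t01 gx gy); exact: expR_gt0. Qed.

Lemma logconcave_concave01 g x y : logconcave g -> 0 < g x -> 0 < g y ->
  concave01 (fun t => ln (g (geo x y t))).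
Proof.
move=> gl gx gy s t lam s01 t01 l01.
have p r : 0 <= r <= 1 -> 0 < g (geo x y r) by move=> r01; exact: logconcave_geo_gt0.
rewrite -geo_geo// -ler_expR lnK; last first.
  by rewrite posrE; apply: logconcave_geo_gt0 => //; exact: p.
by apply: gl.2 => //; exact: p.
Qed.

Lemma null_densely_equal g h x y : null_set [set z | g z != h z] -> x != y ->
  densely_equal (fun t => ln (g (geo x y t))) (fun t => ln (h (geo x y t))).
Proof.
move=> N xy s t s0 st t1.
have s01 : 0 <= s <= 1 by lra.
have t01 : 0 <= t <= 1 by lra.
have [|r /andP[r0 r1]] := @null_geo _ _ _ _ 1 N (geo_inj s01 t01 st xy); first by rewrite ltr01 lexx.
rewrite geo_geo//; last by lra.
move=> /negP; rewrite negbK => /eqP e.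
exists ((1 - r) * s + r * t); first by nra.
by rewrite e.
Qed.

Section TwoLogConcave.
Variables g h : T3 R -> R.
Hypotheses (gl : logconcave g) (hl : logconcave h).
Hypotheses (gh : null_set [set z | g z != h z]) (supp : forall x, 0 < g x <-> 0 < h x).

Lemma null_le_interior x y lam : x != y -> 0 < g x -> 0 < g y -> 0 < lam < 1 ->
  h (geo x y lam) <= g (geo x y lam).
Proof.
move=> xy gx gy l01; have l01' : 0 <= lam <= 1 by lra.
have hx := (supp x).1 gx; have hy := (supp y).1 gy.
rewrite -ler_ln ?posrE; [|exact: logconcave_geo_gt0..].
apply: (@densely_equal_le_interior _ (fun t => ln (g (geo x y t))) (fun t => ln (h (geo x y t)))) => //.
- exact: logconcave_concave01.
- exact: logconcave_concave01.
- exact: null_densely_equal.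
Qed.

Lemma logconcave_max : logconcave (fun x => Num.max (g x) (h x)).
Proof.
have mp x : 0 < Num.max (g x) (h x) -> 0 < g x /\ 0 < h x.
  by rewrite lt_max => /orP[gx|hx]; split => //; apply/supp.
split=> [x|x y lam /[dup] l01 /andP[l0 l1]]; first by rewrite le_max gl.1.
move=> /mp[gx hx] /mp[gy hy].
have [->|xy] := eqVneq x y.
  by rewrite geoxx// -mulrDl subrK mul1r lnK// posrE lt_max gy.
have [->|ln0] := eqVneq lam 0.
  by rewrite geo0 subr0 mul1r mul0r addr0 lnK// posrE lt_max gx.
have [->|ln1] := eqVneq lam 1.
  by rewrite geo1 subrr mul1r mul0r add0r lnK// posrE lt_max gy.
have l01' : 0 < lam < 1 by rewrite !lt_neqAle l0 l1 eq_sym ln0 ln1.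
rewrite le_max; apply/orP; left.
rewrite -[leRHS]lnK ?posrE ?ler_expR; last exact: logconcave_geo_gt0.
have lnmax u v : 0 < u -> 0 < v -> ln (Num.max u v) = Num.max (ln u) (ln v) :> R.
  move=> u0 v0; case: (leP u v) => uv; first by rewrite max_r// ler_ln.
  by rewrite max_l// ler_ln// ltW.
rewrite !lnmax//.
have := @densely_equal_max_chord _ (fun t => ln (g (geo x y t))) (fun t => ln (h (geo x y t))) lam.
rewrite /= !geo0 !geo1; apply => //.
- exact: logconcave_concave01.
- exact: logconcave_concave01.
- exact: null_densely_equal.
Qed.

End TwoLogConcave.

Lemma mass_null_eq g h : (forall x, 0 <= g x) -> branchwise_measurable g ->
  (forall x, 0 <= h x) -> branchwise_measurable h ->
  null_set [set z | g z != h z] -> tint setT g = tint setT h.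
Proof.
move=> g0 mg h0 mh N; rewrite !massE; apply: eq_bigr => k _.
apply: ge0_ae_eq_integral.
- exact: measurable_pos.
- by apply/measurable_EFinP; exact: mg.
- by apply/measurable_EFinP; exact: mh.
- by move=> r _; rewrite lee_fin.
- by move=> r _; rewrite lee_fin.
- apply: negligibleS (N k) => r /= /not_implyP[r0 e]; split => //=.
  by apply/eqP => e'; apply: e; rewrite e'.
Qed.

End AlmostEqual.

Section Uniqueness.
Context {R : realType} (n : nat) (xs : 'I_n -> T3 R).
Hypothesis xs_distinct : exists i j, xs i != xs j.
Implicit Types (g h s : T3 R -> R) (x : T3 R) (c : R).

Let n_gt0 : 0 < n%:R :> R.
Proof. by have [i _] := xs_distinct; rewrite ltr0n; apply: leq_ltn_trans (ltn_ord i). Qed.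

Lemma mle_improve g s c : is_mle xs g -> logconcave s -> (forall i, 0 < s (xs i)) ->
  0 < c -> tint setT s = c%:E ->
  \sum_i ln (s (xs i)) - n%:R * ln c <= \sum_i ln (g (xs i)).
Proof.
move=> gm sl sp c0 sc; have := gm.2 _ (F0_normalize sl c0 sc).
by rewrite loglik_normalize// loglik_pos ?lee_fin//; exact: mle_gt0.
Qed.

Lemma mass_gt0 s : logconcave s -> (forall i, 0 < s (xs i)) -> (0 < tint setT s)%E.
Proof.
move=> sl sp; apply: lt_le_trans (tent_mass_gt0 xs_distinct (fun i => ln (s (xs i)))) _.
apply: mass_le; [exact: tent_ge0|exact: tent_measurable|exact: logconcave_measurable|].
by move=> x; apply: tent_le; split => // i; rewrite lnK ?posrE.
Qed.

Lemma mle_mass_ge1 g s : is_mle xs g -> logconcave s -> (forall i, 0 < s (xs i)) ->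
  \sum_i ln (g (xs i)) <= \sum_i ln (s (xs i)) -> (1 <= tint setT s)%E.
Proof.
move=> gm sl sp gs; have := mass_gt0 sl sp; case sE : (tint setT s) => [c| |]//; last by rewrite leey.
rewrite lte_fin => c0; have := mle_improve gm sl sp c0 sE => h.
have : 0 <= n%:R * ln c.
  have arith (S G u : R) : S - u <= G -> G <= S -> 0 <= u by clear; lra.
  exact: arith h gs.
rewrite pmulr_rge0// => lnc; rewrite lee_fin -[leRHS]lnK// -expR0 ler_expR//.
Qed.

Lemma mle_null_outside g : is_mle xs g ->
  null_set [set x | g x - g x * \1_(hull xs) x != 0].
Proof.
move=> gm; have /F0P[gl g1] := gm.1; have gp := mle_gt0 xs_distinct gm.
pose s x := g x * \1_(hull xs) x.
have sl : logconcave s by apply: logconcave_restrict => // *; exact: hull_convex.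
have sE i : s (xs i) = g (xs i).
  by rewrite /s indicE mem_set ?mulr1//; exact: hull_data.
have sg x : s x <= g x.
  by rewrite /s indicE ler_piMr ?gl.1// lern1 leq_b1.
have s1 : (1 <= tint setT s)%E.
  apply: (mle_mass_ge1 gm) => // [i|]; first by rewrite sE.
  by apply: ler_sum => i _; rewrite sE.
have mg := logconcave_measurable gl; have ms := logconcave_measurable sl.
have md : branchwise_measurable (fun x => g x - s x).
  by move=> k; apply: measurable_funB; [exact: mg|exact: ms].
have d0 x : 0 <= g x - s x by rewrite subr_ge0.
apply: mass_eq0 => //.
have := massD d0 md sl.1 ms; rewrite (_ : (fun x => g x - s x + s x) = g); last first.
  by apply/funext => x; rewrite subrK.
rewrite g1 => e; apply/eqP; rewrite eq_le mass_ge0// andbT.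
rewrite leNgt; apply/negP => dp.
have : (1 < 1 :> \bar R)%E.
  rewrite [ltRHS]e; apply: le_lt_trans s1 _; rewrite lteDr//.
  rewrite ge0_fin_numE ?mass_ge0//; last exact: sl.1.
  apply: (@le_lt_trans _ _ 1%E); last by rewrite ltry.
  by rewrite -g1; apply: mass_le => //; exact: sl.1.
by rewrite ltxx.
Qed.

Lemma mle_support g x : is_mle xs g -> 0 < g x <-> hull xs x.
Proof.
move=> gm; have /F0P[gl g1] := gm.1; have gp := mle_gt0 xs_distinct gm.
have [i0 _] := xs_distinct; split => [gx|hx].
  apply: contrapT => nhx.
  have [tau tau01 avoid] := hull_initial_avoid (xs i0) nhx.
  have xi : x != xs i0 by apply: contra_notN nhx => /eqP ->; exact: hull_data.
  have [t /andP[t0 t1]] := null_geo (mle_null_outside gm) xi tau01.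
  apply; rewrite /= indicE memNset; last by apply: avoid; lra.
  rewrite mulr0 subr0 gt_eqF// logconcave_geo_gt0//.
  by move/andP: tau01 => [? ?]; lra.
have [[i ->]//|/forallNP nx] := pselect (exists i, x = xs i).
have [i [j [lam [l01 _ ->]]]] := hull_between i0 hx nx.
by apply: logconcave_geo_gt0 => //; lra.
Qed.

Lemma ln_sqrt c : 0 < c -> ln (Num.sqrt c) = ln c / 2.
Proof.
move=> c0; have sp : 0 < Num.sqrt c by rewrite sqrtr_gt0.
rewrite -{2}(sqr_sqrtr (ltW c0)) expr2 lnM ?posrE//; lra.
Qed.

Lemma logconcave_geometric_mean g h : logconcave g -> logconcave h ->
  logconcave (fun x => Num.sqrt (g x * h x)).
Proof.
move=> [g0 gc] [h0 hc]; split=> [x|x y lam l01]; first exact: sqrtr_ge0.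
have gt0 z : 0 < g z * h z -> 0 < g z /\ 0 < h z.
  by move=> p; rewrite !lt_neqAle g0 h0 !andbT; split; apply: contraTneq p => <-; rewrite ?mulr0 ?mul0r ltxx.
rewrite !sqrtr_gt0 => /[dup] xp /gt0[gx hx] /[dup] yp /gt0[gy hy].
rewrite !ln_sqrt// !lnM ?posrE//.
have gz := gc _ _ _ l01 gx gy; have hz := hc _ _ _ l01 hx hy.
set u := expR _ in gz; set v := expR _ in hz.
apply: (@le_trans _ _ (Num.sqrt (u * v))); last first.
  by rewrite ler_sqrt ?mulr_ge0//; apply: ler_pM => //; exact: expR_ge0.
rewrite /u /v -expRD.
set w := (X in _ <= Num.sqrt (expR X)).
set w' := (X in expR X <= _).
have -> : w = w' *+ 2 by rewrite /w /w' mulr2n; lra.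
move: (w') => c; by rewrite mulr2n expRD -expr2 sqrtr_sqr ger0_norm// expR_ge0.
Qed.

Lemma mle_ae_unique g h : is_mle xs g -> is_mle xs h -> null_set [set x | g x != h x].
Proof.
move=> gm hm; have /F0P[gl g1] := gm.1; have /F0P[hl h1] := hm.1.
have gp := mle_gt0 xs_distinct gm; have hp := mle_gt0 xs_distinct hm.
pose s x := Num.sqrt (g x * h x).
have sl : logconcave s by exact: logconcave_geometric_mean.
have sp i : 0 < s (xs i) by rewrite sqrtr_gt0 mulr_gt0.
have gh : \sum_i ln (h (xs i)) = \sum_i ln (g (xs i)).
  apply/eqP; rewrite eq_le -!lee_fin -!loglik_pos//.
  by rewrite gm.2 ?hm.2//; [exact: gm.1|exact: hm.1].
have s1 : (1 <= tint setT s)%E.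
  apply: (mle_mass_ge1 gm) => //.
  have -> : \sum_i ln (s (xs i)) = (\sum_i ln (g (xs i)) + \sum_i ln (h (xs i))) / 2.
    rewrite -big_split/= mulr_suml; apply: eq_bigr => i _.
    by rewrite ln_sqrt ?mulr_gt0// lnM ?posrE.
  by rewrite gh mulrDl -splitr.
pose q x := (Num.sqrt (g x) - Num.sqrt (h x)) ^+ 2.
have qE x : g x + h x = q x + 2 * s x.
  rewrite /q /s sqrtrM ?gl.1// sqrrB !sqr_sqrtr ?gl.1 ?hl.1//; ring.
have mg := logconcave_measurable gl; have mh := logconcave_measurable hl.
have ms := logconcave_measurable sl.
have ms2 : branchwise_measurable (fun x => 2 * s x).
  by apply: logconcave_measurable; exact: logconcaveZ.
have mq : branchwise_measurable q.
  have -> : q = fun x => g x + h x - 2 * s x by apply/funext => x; rewrite qE addrK.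
  move=> k; apply: measurable_funB; last exact: ms2.
  by apply: measurable_funD; [exact: mg|exact: mh].
have q0 x : 0 <= q x by exact: sqr_ge0.
have mq0 : tint setT q = 0%E.
  have s20 x : 0 <= 2 * s x by rewrite mulr_ge0// sl.1.
  have := massD q0 mq s20 ms2.
  rewrite -(_ : (fun x => g x + h x) = (fun x => q x + 2 * s x)); last first.
    by apply/funext => x; exact: qE.
  rewrite (massD gl.1 mg hl.1 mh) g1 h1 (massZ _ sl.1 ms)// => e.
  have := mass_ge0 q0; move: e s1.
  case: (tint setT q) => [a| |]//; case: (tint setT s) => [b| |]//=.
    by rewrite -EFinM -!EFinD !lee_fin => -[e] b1 a0; congr EFin; lra.
  - by rewrite gt0_muley ?lte_fin.
  - by rewrite gt0_muley ?lte_fin.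
have := mass_eq0 q0 mq mq0; move=> N k; apply: negligibleS (N k) => r /= [r0 /= ne]; split => //=.
apply: contra ne; rewrite /q sqrf_eq0 subr_eq0 => /eqP e; apply/eqP.
by rewrite -(sqr_sqrtr (gl.1 _)) -(sqr_sqrtr (hl.1 _)) e.
Qed.

Lemma mle_le_data g h i : is_mle xs g -> is_mle xs h -> h (xs i) <= g (xs i).
Proof.
move=> gm hm; have /F0P[gl g1] := gm.1; have /F0P[hl h1] := hm.1.
have gp := mle_gt0 xs_distinct gm; have hp := mle_gt0 xs_distinct hm.
have N := mle_ae_unique gm hm.
have supp x : 0 < g x <-> 0 < h x by rewrite !mle_support.
pose m x := Num.max (g x) (h x).
have ml : logconcave m by exact: logconcave_max.
have mg x : g x <= m x by rewrite le_max lexx.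
have m1 : tint setT m = 1%E.
  rewrite -g1; apply/esym/mass_null_eq => //.
  - exact: gl.1.
  - exact: logconcave_measurable.
  - exact: ml.1.
  - exact: logconcave_measurable.
  - move=> k; apply: negligibleS (N k) => r /= [r0 /= ne]; split => //=.
    by apply: contra ne => /eqP e; rewrite /m -e maxxx.
have mp j : 0 < m (xs j) by exact: lt_le_trans (mg _).
have := mle_improve gm ml mp ltr01 m1.
rewrite ln1 mulr0 subr0 => le; rewrite leNgt; apply/negP => lt.
have : \sum_j ln (g (xs j)) < \sum_j ln (m (xs j)).
  rewrite (bigD1 i)//= [ltRHS](bigD1 i)//=; apply: ltr_leD.
    by rewrite ltr_ln ?posrE// /m lt_max lt orbT.
  by apply: ler_sum => j _; rewrite ler_ln ?posrE.
by rewrite ltNge le.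
Qed.

Lemma mle_le g h x : is_mle xs g -> is_mle xs h -> h x <= g x.
Proof.
move=> gm hm; have /F0P[gl _] := gm.1; have /F0P[hl _] := hm.1.
have gp := mle_gt0 xs_distinct gm.
have supp z : 0 < g z <-> 0 < h z by rewrite !mle_support.
have [hx|hx] := pselect (hull xs x); last first.
  have : ~ 0 < h x by move/(mle_support _ hm).
  by move/negP; rewrite -leNgt => /le_trans; apply; exact: gl.1.
have [[i ->]|/forallNP nx] := pselect (exists i, x = xs i); first exact: mle_le_data.
have [i0 _] := xs_distinct.
have [i [j [lam [l01 ij ->]]]] := hull_between i0 hx nx.
by apply: null_le_interior => //; exact: mle_ae_unique.
Qed.

Theorem mle_exists_unique_distinct : mle_exists_unique xs.
Proof.
have [g gm] := mle_exists xs_distinct; exists g; split => // h hm.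
by apply/funext => x; apply/eqP; rewrite eq_le !mle_le.
Qed.

End Uniqueness.

(** * Coincidences in the sample *)

Section IndependentAtomless.
Context {R : realType} {d : measure_display} {Omega : measurableType d}.
Variable P : probability Omega R.

Lemma indep_diagonal_negligible (Y0 Y1 : {mfun Omega >-> R}) :
  (forall A B : set R, measurable A -> measurable B ->
    P (Y0 @^-1` A `&` Y1 @^-1` B) = (P (Y0 @^-1` A) * P (Y1 @^-1` B))%E) ->
  (forall r : R, r != 0 -> P (Y1 @^-1` [set r]) = 0%E) ->
  P.-negligible [set w | Y0 w = Y1 w /\ Y0 w != 0].
Proof.
move=> indep atomless.
have mY : measurable_fun setT (fun w => (Y0 w, Y1 w)).
  by apply: measurable_fun_pair; exact: measurable_funP.
pose Y : {mfun Omega >-> (R * R)%type} := HB.pack (fun w => (Y0 w, Y1 w))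
  (isMeasurableFun.Build _ _ _ _ (fun w => (Y0 w, Y1 w)) mY).
pose D : set (R * R) := [set z | z.1 = z.2 /\ z.1 != 0].
have mD : measurable D.
  have m1 : measurable_fun setT (fst : R * R -> R) by exact: measurable_fst.
  have m2 : measurable_fun setT (snd : R * R -> R) by exact: measurable_snd.
  have e1 : measurable_fun setT (fun z : R * R => (z.1 == z.2) && ~~ (z.1 == 0)).
    apply: measurable_and; first exact: measurable_fun_eqr.
    by apply: measurable_neg; exact: measurable_fun_eqr.
  have := e1 measurableT [set true] I; rewrite setTI.
  congr measurable; apply/seteqP; split => z /=; first by move=> /andP[/eqP].
  by move=> [-> ->]; rewrite eqxx.
have mDE : P (Y @^-1` D) = 0%E.
  rewrite -[LHS]/(distribution P Y D).
  rewrite -(@product_measure_unique _ _ _ _ _ (distribution P Y0) (distribution P Y1) (distribution P Y) _ D mD).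
    rewrite /product_measure1/=; apply: integral0_eq => x _ /=.
    have [x0|x0] := eqVneq x 0.
      rewrite (_ : xsection D x = set0) ?measure0//.
      by apply/seteqP; split => y //; rewrite /xsection/= inE => -[/= _]; rewrite x0 eqxx.
    rewrite (_ : xsection D x = [set x]); first exact: atomless.
    by apply/seteqP; split => y; rewrite /xsection/= inE /D/=; [case=> ->|move=> ->].
  by move=> A B mA mB; exact: indep.
have := mY measurableT D mD; rewrite setTI => mYD.
by apply/negligibleP; [exact: mYD|exact: mDE].
Qed.

End IndependentAtomless.

Section Sample.
Context {R : realType}.
Implicit Types (x : T3 R) (k : 'I_3).

Definition branch_coord k x : R := if br x == k then rad x else 0.

Lemma branch_coord_mkT j k r : 0 < r ->
  branch_coord k (mkT j r) = if j == k then r else 0.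
Proof. by move=> r0; rewrite /branch_coord br_mkT// rad_mkT. Qed.

Lemma tmeasurable_setT : tmeasurable (setT : set (T3 R)).
Proof.
move=> k; rewrite (_ : trace _ _ = [set r | 0 < r]); first exact: measurable_pos.
by apply/seteqP; split => r //= -[].
Qed.

Lemma tmeasurable_branch_coord k (A : set R) : measurable A ->
  tmeasurable (branch_coord k @^-1` A).
Proof.
move=> mA j; have [jk|jk] := eqVneq j k.
  rewrite (_ : trace _ _ = [set r | 0 < r] `&` A).
    by apply: measurableI => //; exact: measurable_pos.
  by apply/seteqP; split => r /= [r0 Ar]; split => //; move: Ar; rewrite /= branch_coord_mkT// jk eqxx.
have [A0|A0] := pselect (A 0).
  rewrite (_ : trace _ _ = [set r | 0 < r]); first exact: measurable_pos.
  apply/seteqP; split => r /=; first by case.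
  by move=> r0; split => //=; rewrite branch_coord_mkT// (negbTE jk).
rewrite (_ : trace _ _ = set0)//.
by apply/seteqP; split => r //= [r0]; rewrite /= branch_coord_mkT// (negbTE jk).
Qed.

Lemma tint_trace_sub1 (A : set (T3 R)) (f : T3 R -> R) (r : R) :
  (forall k, trace A k `<=` [set r]) -> tint A f = 0%E.
Proof. by move=> Ar; rewrite /tint big1// => k _; apply: integral_Sset1 (Ar k). Qed.

End Sample.

Section SampleDistinct.
Context {R : realType} {d : measure_display} {Omega : measurableType d}.
Variables (P : probability Omega R) (n : nat) (f : T3 R -> R) (X : 'I_n -> Omega -> T3 R).
Hypothesis Xmeas : forall (i : 'I_n) (A : set (T3 R)), tmeasurable A ->
  measurable (X i @^-1` A).
Hypothesis Xlaw : forall (i : 'I_n) (A : set (T3 R)), tmeasurable A ->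
  P (X i @^-1` A) = tint A f.
Hypothesis Xindep : forall A : 'I_n -> set (T3 R), (forall i, tmeasurable (A i)) ->
  P [set w | forall i, A i (X i w)] = (\prod_(i < n) P (X i @^-1` A i))%E.

Lemma indep_pair (i j : 'I_n) (A B : set (T3 R)) : i != j -> tmeasurable A -> tmeasurable B ->
  P (X i @^-1` A `&` X j @^-1` B) = (P (X i @^-1` A) * P (X j @^-1` B))%E.
Proof.
move=> ij mA mB.
pose C k := if k == i then A else if k == j then B else setT.
have mC k : tmeasurable (C k).
  by rewrite /C; case: ifP => // _; case: ifP => // _; exact: tmeasurable_setT.
have := Xindep mC.
rewrite (_ : [set w | forall k, C k (X k w)] = X i @^-1` A `&` X j @^-1` B); last first.
  apply/seteqP; split => w /=.
    move=> h; split; first by have := h i; rewrite /C eqxx.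
    by have := h j; rewrite /C eqxx eq_sym (negbTE ij).
  by move=> [Aw Bw] k; rewrite /C; case: eqVneq => [->//|_]; case: eqVneq => [->//|].
move=> ->; rewrite (bigD1 i)//= (bigD1 j)/=; last by rewrite eq_sym.
rewrite big1 ?mule1; last first.
  move=> k /andP[ki kj]; rewrite /C (negbTE ki) (negbTE kj) preimage_setT.
  exact: probability_setT.
by rewrite /C !eqxx eq_sym (negbTE ij).
Qed.

Lemma coincidence_negligible (i j : 'I_n) : i != j ->
  P.-negligible [set w | X i w = X j w].
Proof.
move=> ij.
pose Y k l w := branch_coord k (X l w).
have mY k l : measurable_fun setT (Y k l).
  move=> _ A mA; rewrite setTI; apply: (Xmeas l (A := branch_coord k @^-1` A)).
  exact: tmeasurable_branch_coord.
have mono_orig : tmeasurable [set orig R].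
  move=> k; rewrite (_ : trace _ _ = set0)//.
  by apply/seteqP; split => r //= [r0 /(congr1 (@rad R))]; rewrite rad_mkT// => e; move: r0; rewrite e ltxx.
have N k : P.-negligible [set w | Y k i w = Y k j w /\ Y k i w != 0].
  pose Yi : {mfun Omega >-> R} := HB.pack (Y k i) (isMeasurableFun.Build _ _ _ _ (Y k i) (mY k i)).
  pose Yj : {mfun Omega >-> R} := HB.pack (Y k j) (isMeasurableFun.Build _ _ _ _ (Y k j) (mY k j)).
  apply: (@indep_diagonal_negligible _ _ _ P Yi Yj).
    by move=> A B mA mB; apply: (@indep_pair i j (branch_coord k @^-1` A) (branch_coord k @^-1` B)) => //;
      exact: tmeasurable_branch_coord.
  move=> r r0; rewrite -[LHS]/(P (X j @^-1` (branch_coord k @^-1` [set r]))).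
  rewrite Xlaw; last by apply: tmeasurable_branch_coord; exact: measurable_set1.
  apply: (@tint_trace_sub1 _ _ _ r) => l s /= [s0].
  rewrite /= branch_coord_mkT//; case: ifP => // _ e.
  by move: r0; rewrite -e eqxx.
have O : P.-negligible (X i @^-1` [set orig R]).
  have PO : P (X i @^-1` [set orig R]) = 0%E; last first.
    by apply/negligibleP; [exact: Xmeas|exact: PO].
  rewrite Xlaw//; apply: (@tint_trace_sub1 _ _ _ 0) => k s /= [s0 /(congr1 (@rad R))].
  by rewrite rad_mkT.
have := negligibleU O (negligible_bigcup (fun m => N (inord m))).
apply: negligibleS => w /= e.
have [/rad_eq0 r0|r0] := eqVneq (rad (X i w)) 0; first by left.
right; exists (br (X i w)) => //=; rewrite inord_val /Y e; split => //.
by rewrite /branch_coord -e eqxx.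
Qed.

End SampleDistinct.

Theorem theorem3 (R : realType) (d : measure_display) (Omega : measurableType d)
  (P : probability Omega R) (n : nat) (hn : (2 <= n)%N)
  (f : T3 R -> R) (hf : F0 f) (X : 'I_n -> Omega -> T3 R)
  (hXmeas : forall (i : 'I_n) (A : set (T3 R)), tmeasurable A ->
              measurable (X i @^-1` A))
  (hXlaw : forall (i : 'I_n) (A : set (T3 R)), tmeasurable A ->
              P (X i @^-1` A) = tint A f)
  (hXindep : forall A : 'I_n -> set (T3 R), (forall i, tmeasurable (A i)) ->
              P [set w | forall i, A i (X i w)] =
              (\prod_(i < n) P (X i @^-1` A i))%E) :
  {ae P, forall w, mle_exists_unique (fun i => X i w)}.
Proof.
pose i0 : 'I_n := Ordinal (ltnW hn); pose i1 : 'I_n := Ordinal hn.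
have := coincidence_negligible hXmeas hXlaw hXindep (isT : i0 != i1).
apply: negligibleS => w /= nuniq; apply: contrapT => /eqP ne; apply: nuniq.
by apply: mle_exists_unique_distinct; exists i0, i1.
Qed.
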